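(* Consider the finite-template variance-shift detection model with templates $\Sigma_1,\dots,\Sigma_m\in\mathbb{R}_+^{k\times k}$ (described in the context). Let $\nu_{\mathsf{det}}=\sum_{\ell=1}^m\sum_{u,v\in[k]}(\Sigma_\ell)_{uv}$ and $\mathsf{KL}(\Sigma)=\frac12\sum_{u,v\in[k]}\left[\Sigma_{uv}-\log(1+\Sigma_{uv})\right]$. The following statements hold. 1. If $\nu_{\mathsf{det}}=\omega(n)$, then the global quadratic test $\mathcal{A}_{\mathsf{quad}}$ satisfies $\mathsf{R}(\mathcal{A}_{\mathsf{quad}})=o(1)$ under the non-consecutive placement family $\mathcal{K}_{k,m,n}$ and under both consecutive placement families $\mathcal{K}^{\mathsf{con}}_{k,m,n}$ and $\mathcal{K}^{\circ}_{k,m,n}$. 2. If $\max_{\ell\in[m]}\mathsf{KL}(\Sigma_\ell)=\omega\left(k\log\frac{n}{k}+\log m\right)$, then, under the non-consecutive placement family $\mathcal{K}_{k,m,n}$, the finite-template scan test $\mathcal{A}^{\sigma}_{\mathsf{scan}}(\cdot\,;\mathcal{B}_{k,n})$ satisfies $\mathsf{R}(\mathcal{A}^{\sigma}_{\mathsf{scan}})=o(1)$. 3. If $\max_{\ell\in[m]}\mathsf{KL}(\Sigma_\ell)=\omega(\log n+\log m)$, then, under the standard consecutive placement family $\mathcal{K}^{\mathsf{con}}_{k,m,n}$, the finite-template scan test $\mathcal{A}^{\sigma}_{\mathsf{scan}}(\cdot\,;\mathcal{B}^{\mathsf{con}}_{k,n})$ satisfies $\mathsf{R}(\mathcal{A}^{\sigma}_{\mathsf{scan}})=o(1)$;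 the same holds for $\mathcal{A}^{\sigma}_{\mathsf{scan}}(\cdot\,;\mathcal{B}^{\circ}_{k,n})$ under the circular consecutive placement family $\mathcal{K}^{\circ}_{k,m,n}$.
   Context: **Asymptotics.** All asymptotic statements are as $n\to\infty$; $m=m(n)$, $k=k(n)$ are positive integers with $mk\le n$, and the templates may depend on $n$. $[k]=\{1,\dots,k\}$; $a_n=\omega(b_n)$ and $o(1)$ have their usual meanings. **Blocks and placements.** $\mathcal{B}_{k,n}=\{S\times T: S,T\subset[n],\ |S|=|T|=k\}$ (non-consecutive blocks). $\mathcal{B}^{\mathsf{con}}_{k,n}$ is the set of $S\times T$ with $S,T\in\{\{i+1,\dots,i+k\}:i=0,\dots,n-k\}$ (standard consecutive). $\mathcal{B}^{\circ}_{k,n}$ is the set of $S\times T$ with $S,T\in\{\{i+1,\dots,i+k\}\bmod n: i=0,\dots,n-1\}$, indices taken modulo $n$ with representatives in $[n]$ (circular consecutive). The placement families $\mathcal{K}_{k,m,n}$, $\mathcal{K}^{\mathsf{con}}_{k,m,n}$, $\mathcal{K}^{\circ}_{k,m,n}$ are the sets of all unordered collections of $m$ pairwise disjoint blocks from $\mathcal{B}_{k,n}$, $\mathcal{B}^{\mathsf{con}}_{k,n}$, $\mathcal{B}^{\circ}_{k,n}$, respectively. For a block $B=S\times T$ with $S=\{s_1<\dots<s_k\}$, $T=\{t_1<\dots<t_k\}$, the coordinate map $\varphi_B:B\to[k]\times[k]$ is $\varphi_B(s_u,t_v)=(u,v)$. **Variance-shift model.** The templates $\Sigma_\ell$ have nonnegative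 entries with $\max_{u,v}(\Sigma_\ell)_{uv}\le\vartheta_0$ for all $\ell$, where $\vartheta_0\in[0,1)$ is fixed independently of $n$. One observes $X\in\mathbb{R}^{n\times n}$. Under $\mathcal{H}_0$ the entries are i.i.d. $\mathcal{N}(0,1)$ (law $\mathbb{P}_{\mathcal{H}_0}$). Under $\mathcal{H}_1$, $K$ is drawn uniformly from the specified placement family, then, conditional on $K$, a bijection $\beta:K\to[m]$ is drawn uniformly; given $(K,\beta)$ the entries of $X$ are independent with $X_{ij}\sim\mathcal{N}\big(0,1+(\Sigma_{\beta(B)})_{\varphi_B(i,j)}\big)$ if $(i,j)\in B$ for some $B\in K$, and $X_{ij}\sim\mathcal{N}(0,1)$ otherwise. $\mathbb{P}_{\mathcal{H}_1}$ is the resulting marginal (mixture) law of $X$. The risk of a test $\mathcal{A}_n:\mathbb{R}^{n\times n}\to\{0,1\}$ is $\mathsf{R}(\mathcal{A}_n)=\mathbb{P}_{\mathcal{H}_0}(\mathcal{A}_n(X)=1)+\mathbb{P}_{\mathcal{H}_1}(\mathcal{A}_n(X)=0)$. **Global quadratic test.** $\mathcal{A}_{\mathsf{quad}}(X)=\mathbb{1}\{\sum_{i,j\in[n]}(X_{ij}^2-1)\ge\nu_{\mathsf{det}}/2\}$. **Finite-template scan test.** For $\mathcal{B}\in\{\mathcal{B}_{k,n},\mathcal{B}^{\mathsf{con}}_{k,n},\mathcal{B}^{\circ}_{k,n}\}$ and a template $\Sigma$, let $$\mathsf{T}^{\sigma}_{\mathsf{scan}}(X;\mathcal{B},\Sigma)=\max_{B\in\mathcal{B}}\sum_{(i,j)\in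 B}\frac12\Big(\frac{\Sigma_{\varphi_B(i,j)}}{1+\Sigma_{\varphi_B(i,j)}}X_{ij}^2-\log\big(1+\Sigma_{\varphi_B(i,j)}\big)\Big),$$ and $\mathcal{A}^{\sigma}_{\mathsf{scan}}(X;\mathcal{B})=\mathbb{1}\{\max_{\ell\in[m]}\mathsf{T}^{\sigma}_{\mathsf{scan}}(X;\mathcal{B},\Sigma_\ell)\ge\tau^{\sigma}_{\mathsf{scan}}(\mathcal{B})\}$, where, for a fixed constant $\delta>0$, $\tau^{\sigma}_{\mathsf{scan}}(\mathcal{B}_{k,n})=(1+\delta)\big(2k\log\frac{en}{k}+\log m\big)$ and $\tau^{\sigma}_{\mathsf{scan}}(\mathcal{B})=(1+\delta)(2\log n+\log m)$ for $\mathcal{B}\in\{\mathcal{B}^{\mathsf{con}}_{k,n},\mathcal{B}^{\circ}_{k,n}\}$.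
   Formalization: Part 2 additionally assumes max KL(Σ_ℓ) = ω(k); as printed it fails for m = 1, k = n−1, where k log(n/k) stays bounded but the scan threshold is at least 2(n−1). The addition is automatic when k/n stays away from 1 (e.g. m ≥ 2). *)

(* Defs.v *)
From HB Require Import structures.
From mathcomp Require Import all_boot all_order all_algebra.
From mathcomp Require Import all_classical all_reals all_analysis.

Set Implicit Arguments.
Unset Strict Implicit.
Unset Printing Implicit Defensive.

Import Order.TTheory GRing.Theory Num.Theory.
Import numFieldNormedType.Exports.

Local Open Scope ring_scope.

(* [n] = {1, ..., n} is rendered as 'I_n = {0, ..., n - 1} throughout. *)

Section tuple_prob.
Context d (T : measurableType d) (R : realType).

Definition cons_pair n (p : T * n.-tuple T) : n.+1.-tuple T :=
  [tuple of p.1 :: p.2].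

Lemma measurable_cons_pair n : measurable_fun [set: T * n.-tuple T]%classic
  (@cons_pair n).
Proof. exact: measurable_cons. Qed.

HB.instance Definition _ n :=
  isMeasurableFun.Build _ _ _ _ (@cons_pair n) (@measurable_cons_pair n).

Fixpoint tuple_prob n :
    ('I_n -> probability T R) -> probability (n.-tuple T) R :=
  match n with
  | 0 => fun=> \d_ [tuple]
  | n'.+1 => fun P =>
      distribution (P ord0 \x tuple_prob (fun i => P (lift ord0 i)))%E
                   (@cons_pair n')
  end.

Lemma tuple_prob_box n (P : 'I_n -> probability T R) (A : 'I_n -> set T) :
  (forall i, measurable (A i)) ->
  tuple_prob P [set t | forall i, A i (tnth t i)]%classic =
  (\prod_i P i (A i))%E.
Proof.
elim: n P A => [|n IHn] P A mA.
  rewrite big_ord0 /= diracE mem_set//= => -[]//.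
rewrite big_ord_recl -IHn; last by move=> i; exact: mA.
rewrite -product_measure1E//=.
  rewrite /distribution /pushforward; congr (product_measure1 _ _ _).
  apply/seteqP; split => [[x t]/= h|[x t] [/= h0 h] i].
    by split=> /= [|i]; [exact: (h ord0)|have := h (lift ord0 i); rewrite tnthS].
  by case: (unliftP ord0 i) => [j|] ->; [rewrite tnthS; exact: h|exact: h0].
rewrite (_ : [set _ | _]%classic =
  \bigcap_(i in [set: 'I_n]) ((@tnth n T)^~ i @^-1` (A (lift ord0 i))))%classic.
  apply: fin_bigcap_measurable => // i _; rewrite -[X in measurable X]setTI.
  by apply: measurable_tnth => //; exact: mA.
by apply/seteqP; split => [t h i _|t h i]; [exact: h|exact: (h i)].
Qed.

End tuple_prob.

Section measurable_matrix.
Context (R : realType) (n : nat).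

Definition mx_cylinder : set (set 'M[R]_n) :=
  [set A | exists (i j : 'I_n) (B : set (measurableTypeR R)),
     measurable B /\ A = [set X : 'M[R]_n | B (X i j)]]%classic.

Let mx_set0 : (<<s mx_cylinder >> set0)%classic.
Proof. exact: sigma_algebra0. Qed.

Let mx_setC A : (<<s mx_cylinder >> A -> <<s mx_cylinder >> (~` A))%classic.
Proof. exact: sigma_algebraC. Qed.

Let mx_bigcup (F : (set 'M[R]_n)^nat) :
  (forall i, <<s mx_cylinder >> (F i))%classic ->
  (<<s mx_cylinder >> (\bigcup_i F i))%classic.
Proof. exact: sigma_algebra_bigcup. Qed.

HB.instance Definition _ := @isMeasurable.Build default_measure_display
  'M[R]_n <<s mx_cylinder >>%classic mx_set0 mx_setC mx_bigcup.

End measurable_matrix.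

Section matrix_prob.
Context (R : realType) (n : nat).
Local Notation cell := ('I_n * 'I_n)%type.

Definition mx_of_tuple (t : #|{: cell}|.-tuple (measurableTypeR R)) : 'M[R]_n :=
  \matrix_(i, j) tnth t (enum_rank (i, j)).

Lemma measurable_mx_of_tuple : measurable_fun setT mx_of_tuple.
Proof.
apply: (@measurability _ _ _ _ _ _ (@mx_cylinder R n)) => // _ [_ [i [j [B [mB ->]]]] <-].
rewrite (_ : mx_of_tuple @^-1` _ =
  (fun t => tnth t (enum_rank (i, j))) @^-1` B)%classic.
  exact: measurable_tnth.
by apply/seteqP; split => t /=; rewrite mxE.
Qed.

HB.instance Definition _ :=
  isMeasurableFun.Build _ _ _ _ mx_of_tuple measurable_mx_of_tuple.

Definition matrix_prob (P : 'I_n -> 'I_n -> probability (measurableTypeR R) R) :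
    probability 'M[R]_n R :=
  distribution (tuple_prob (fun l => P (enum_val l).1 (enum_val l).2))
               mx_of_tuple.

Lemma matrix_prob_box (P : 'I_n -> 'I_n -> probability (measurableTypeR R) R)
    (A : 'I_n -> 'I_n -> set (measurableTypeR R)) :
  (forall i j, measurable (A i j)) ->
  matrix_prob P [set X : 'M[R]_n | forall i j, A i j (X i j)]%classic =
  (\prod_i \prod_j P i j (A i j))%E.
Proof.
move=> mA; rewrite pair_bigA/=.
rewrite (reindex (@enum_val _ {: cell})); last first.
  by exists enum_rank => ? _; rewrite ?enum_rankK ?enum_valK.
rewrite -(@tuple_prob_box _ _ _ _ (fun l => P (enum_val l).1 (enum_val l).2)
  (fun l => A (enum_val l).1 (enum_val l).2))//.
rewrite /matrix_prob /= /distribution /pushforward; congr (tuple_prob _ _).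
apply/seteqP; split => t /= h.
  by move=> l; have := h (enum_val l).1 (enum_val l).2;
    rewrite mxE -surjective_pairing enum_valK.
by move=> i j; rewrite mxE; have := h (enum_rank (i, j)); rewrite enum_rankK.
Qed.

End matrix_prob.

Definition block n := ({set 'I_n} * {set 'I_n})%type.

Definition cells n (B : block n) : {set 'I_n * 'I_n} := finset.setX B.1 B.2.

Definition blocks k n : {set block n} :=
  [set B : block n | (#|B.1| == k) && (#|B.2| == k)]%SET.

Definition intervals k n : {set {set 'I_n}} :=
  [set [set x : 'I_n | (i <= x < i + k)%N]%SET | i : 'I_(n - k).+1]%SET.

Definition arcs k n : {set {set 'I_n}} :=
  [set [set x : 'I_n | [exists j : 'I_k, (x == (i + j) %% n :> nat)%N]]%SET
     | i : 'I_n]%SET.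

Definition con_blocks k n : {set block n} :=
  finset.setX (intervals k n) (intervals k n).

Definition circ_blocks k n : {set block n} := finset.setX (arcs k n) (arcs k n).

(* The unordered collections of m pairwise disjoint blocks from F. For k > 0 a
   block is determined by its cells, so a set of pairs (S, T) is the same thing
   as a set of products S x T. *)
Definition placements n (F : {set block n}) (m : nat) : {set {set block n}} :=
  [set K : {set block n} | [&& K \subset F, #|K| == m &
     [forall B in K, forall B' in K,
        (B != B') ==> [disjoint cells B & cells B']]]]%SET.

(* u such that i = s_u for S = {s_0 < ... < s_(k-1)}; None if u >= k. *)
Definition coord k n (S : {set 'I_n}) (i : 'I_n) : option 'I_k :=
  insub #|[set x in S | (x < i)%N]%SET|.

Lemma coord_in k n (S : {set 'I_n}) i :
  #|S| = k -> i \in S -> exists u : 'I_k, coord k S i = Some u.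
Proof.
move=> Sk iS; rewrite /coord; case: insubP => [u _ _|]; first by exists u.
rewrite -leqNgt -Sk => /(leq_trans _) h; have := proper_card (A :=
  mem [set x in S | (x < i)%N]%SET) (B := mem S).
move=> /(_ _)/h; rewrite ltnn => /(_ _)/negP; case=> //.
apply/properP; split; first by apply/fintype.subsetP => x; rewrite inE => /andP[].
by exists i => //; rewrite inE ltnn andbF.
Qed.

(* The entry of the template Sigma at phi_B(i, j); only meant for (i, j) in
   cells B with B in blocks k n, and 0 by convention if phi_B is undefined. *)
Definition template_at (R : realType) k n (Sigma : 'M[R]_k) (B : block n)
    (i j : 'I_n) : R :=
  if (coord k B.1 i, coord k B.2 j) is (Some u, Some v) then Sigma u v else 0.

Section model.
Context (R : realType) (k m n : nat).
Implicit Types (Sigma : 'I_m -> 'M[R]_k) (F K : {set block n}).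

(* normal_prob takes the standard deviation, not the variance. *)
Definition centered_gaussian_law (v : 'I_n -> 'I_n -> R) :
    probability 'M[R]_n R :=
  matrix_prob (fun i j => normal_prob 0 (Num.sqrt (v i j))).

Definition H0_law : probability 'M[R]_n R := centered_gaussian_law (fun _ _ => 1).

Definition bijections K : {set {ffun {B | B \in K} -> 'I_m}} :=
  [set b : {ffun {B | B \in K} -> 'I_m} |
     injectiveb b && [forall l, l \in codom b]]%SET.

(* The blocks of K being disjoint, the sum has at most one term. *)
Definition H1_variance Sigma K (b : {ffun {B | B \in K} -> 'I_m})
    (i j : 'I_n) : R :=
  1 + \sum_(B : {B | B \in K} | (i, j) \in cells (val B))
        template_at (Sigma (b B)) (val B) i j.

Definition uniform_average (T : finType) (E : {set T}) (f : T -> \bar R) :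
    \bar R :=
  ((#|E|%:R^-1)%:E * \sum_(x in E) f x)%E.

Definition H1_law Sigma F (A : set 'M[R]_n) : \bar R :=
  uniform_average (placements F m) (fun K =>
    uniform_average (bijections K) (fun b =>
      centered_gaussian_law (H1_variance Sigma b) A)).

Definition risk Sigma F (test : 'M[R]_n -> bool) : \bar R :=
  (H0_law [set X | test X = true]%classic +
   H1_law Sigma F [set X | test X = false]%classic)%E.

Definition nu_det Sigma : R := \sum_l \sum_u \sum_v Sigma l u v.

Definition KL (S : 'M[R]_k) : R :=
  2^-1 * \sum_u \sum_v (S u v - ln (1 + S u v)).

(* The base value 0 is harmless: KL is nonnegative on nonnegative matrices. *)
Definition max_KL Sigma : R := \big[Num.max/0]_l KL (Sigma l).

Definition quad_test Sigma (X : 'M[R]_n) : bool :=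
  nu_det Sigma / 2 <= \sum_i \sum_j (X i j ^+ 2 - 1).

Definition scan_stat F (S : 'M[R]_k) (X : 'M[R]_n) : \bar R :=
  \big[maxe/-oo%E]_(B in F)
    (\sum_(c in cells B)
       let s := template_at S B c.1 c.2 in
       2^-1 * (s / (1 + s) * X c.1 c.2 ^+ 2 - ln (1 + s)))%:E.

Definition scan_test Sigma F (tau : R) (X : 'M[R]_n) : bool :=
  (tau%:E <= \big[maxe/-oo%E]_l scan_stat F (Sigma l) X)%E.

Definition scan_threshold (delta : R) : R :=
  (1 + delta) * (2 * k%:R * ln (expR 1 * n%:R / k%:R) + ln m%:R).

Definition con_scan_threshold (delta : R) : R :=
  (1 + delta) * (2 * ln n%:R + ln m%:R).

End model.

Local Open Scope classical_set_scope.

(* a_n = omega(b_n), i.e. b_n = o(a_n) as n -> oo. *)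
Definition is_omega (R : realType) (a b : nat -> R) : Prop :=
  (b : nat -> R^o) =o_\oo (a : nat -> R^o).

Lemma is_omegaP (R : realType) (a b : nat -> R) :
  is_omega a b <->
  forall C, 0 < C -> \forall n \near \oo, C * `|b n| <= `|a n|.
Proof.
rewrite /is_omega; split => [/eqoP h C C0|h].
  have /h : 0 < C^-1 by rewrite invr_gt0.
  by apply: filterS => n /=; rewrite mulrC ler_pdivlMr// mulrC.
apply/eqoP => e e0; have /h : 0 < e^-1 by rewrite invr_gt0.
by apply: filterS => n /=; rewrite mulrC ler_pdivrMr// mulrC.
Qed.

(* The scan over blocks k n has threshold of order
   k ln (e n / k) + ln m = k ln (n / k) + ln m + k, so a signal of order
   omega (k ln (n / k) + ln m) exceeds it once it is also omega (k). The latter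
   is automatic, by this lemma, as soon as k / n stays away from 1; this always
   holds where m >= 2, since then k <= n / 2. It has content only for a single
   block covering almost the whole matrix: for m = 1 and k = n - 1, the rate
   k ln (n / k) + ln m is bounded whereas the threshold is at least 2 (n - 1). *)
Lemma is_omega_block_size (R : realType) (k m : nat -> nat) (a : nat -> R)
    (c : R) :
  0 < c < 1 ->
  (\forall n \near \oo,
     [/\ (0 < k n)%N, (0 < m n)%N & (k n)%:R <= c * n%:R]) ->
  is_omega a (fun n => (k n)%:R * ln (n%:R / (k n)%:R) + ln (m n)%:R) ->
  is_omega a (fun n => (k n)%:R).
Proof.
move=> /andP[c0 c1] hk /is_omegaP h; apply/is_omegaP => C C0.
have L0 : 0 < - ln c by rewrite oppr_gt0 ln_lt0// c0.
have := h (C / - ln c) (divr_gt0 C0 L0).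
apply: filterS2 hk => n [k0 m0 kc]; apply: le_trans.
have kR : 0 < (k n)%:R :> R by rewrite ltr0n.
have nR : 0 < n%:R :> R by rewrite -(pmulr_rgt0 _ c0) (lt_le_trans kR).
have le_ln : - ln c <= ln (n%:R / (k n)%:R).
  rewrite -lnV ?posrE// ler_ln ?posrE ?invr_gt0 ?divr_gt0//.
  by rewrite ler_pdivlMr// ler_pdivrMl.
rewrite -mulrA ler_pM2l// ler_pdivlMl// (ger0_norm (ltW kR)).
apply: le_trans (ler_norm _); rewrite mulrC.
apply: (@le_trans _ _ ((k n)%:R * ln (n%:R / (k n)%:R))).
  by rewrite ler_pM2l.
by rewrite lerDl ln_ge0// ler1n.
Qed.

(* Main.v *)
Require Import Defs.
From mathcomp Require Import all_boot all_order all_algebra.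
From mathcomp Require Import all_classical all_reals all_analysis.
From mathcomp Require Import ring lra measurable_realfun.

(* Every error probability is bounded by Chernoff's method, using
   E exp(a Y^2) = (1 - 2 a v)^(-1/2) for Y ~ N(0, v) with 2 a v < 1, and
   ln (1 + x) >= x / (1 + x) to linearize the resulting sums of logarithms.

   Quadratic test: with exponent 1/n under H0 and -1/n under H1, both errors
   are at most exp(8 - nu / (2 n)), since the variances exceed 1 by nu in total.

   Scan test: each block statistic is a log-likelihood ratio, so under H0 the
   union bound gives m |F| exp(-tau). Under H1 it suffices to look at the block
   of K that carries a template of maximal KL; with exponent -1/2, each of its
   cells contributes a factor exp(- (s - ln (1 + s)) / 36) (s being the variance
   shift), whence the bound exp(tau / 2 - max_KL / 18). *)

Set Implicit Arguments.
Unset Strict Implicit.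
Unset Printing Implicit Defensive.

Import Order.TTheory GRing.Theory Num.Theory.
Import numFieldNormedType.Exports.

Local Open Scope classical_set_scope.
Local Open Scope ring_scope.

(** * Gaussian exponential moments *)

(** The Radon-Nikodym derivative of the normal law and [normal_pdf] have the same integral over
    every measurable set, so they agree almost everywhere and the change of variables may use the
    explicit density. *)
Lemma ge0_integral_normal_prob (R : realType) (m s : R)
    (f : R -> \bar R) :
  measurable_fun setT f -> (forall x, 0 <= f x)%E ->
  (\int[normal_prob m s]_x f x =
   \int[lebesgue_measure]_x (f x * (normal_pdf m s x)%:E))%E.
Proof.
move=> mf f0; have dom := normal_prob_dominates m s.
rewrite -(Radon_Nikodym_SigmaFinite.change_of_variables dom f0 measurableT mf).
have mpdf : measurable_fun setT (EFin \o normal_pdf m s).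
  by apply/measurable_EFinP; exact: measurable_normal_pdf.
have irn := Radon_Nikodym_SigmaFinite.f_integrable dom.
apply: ae_eq_integral => //.
- by apply: emeasurable_funM => //; exact: measurable_int irn.
- exact: emeasurable_funM.
apply: ae_eqe_mul2l; apply: integral_ae_eq => // E _ mE.
by rewrite -Radon_Nikodym_SigmaFinite.f_integral.
Qed.

(** Multiplying the N(0, v) density by exp(a x^2) gives a multiple of the N(0, w) density with w = v
    / (1 - 2 a v). The factor (1 - 2 a v)^(-1/2) is written through [expR] and [ln] so that products
    over cells become sums. *)
Lemma normal_prob_exp_square (R : realType) (v a : R) :
  0 < v -> 2 * (a * v) < 1 ->
  (\int[normal_prob 0 (Num.sqrt v)]_x (expR (a * x ^+ 2))%:E =
   (expR (- 2^-1 * ln (1 - 2 * (a * v))))%:E)%E.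
Proof.
move=> v0 av; have d0 : 0 < 1 - 2 * (a * v) by rewrite subr_gt0.
have mexp : measurable_fun setT (fun x : R => expR (a * x ^+ 2)).
  by apply: measurableT_comp => //; exact: measurable_funM.
rewrite ge0_integral_normal_prob; [|exact/measurable_EFinP|
  by move=> x; rewrite lee_fin expR_ge0].
pose w := v / (1 - 2 * (a * v)); have w0 : 0 < w by rewrite divr_gt0.
have sv := sqr_sqrtr (ltW v0); have sw := sqr_sqrtr (ltW w0).
transitivity (\int[lebesgue_measure]_x
    ((expR (- 2^-1 * ln (1 - 2 * (a * v))))%:E *
     (normal_pdf 0 (Num.sqrt w) x)%:E))%E.
  apply: eq_integral => x _; rewrite -!EFinM; congr EFin.
  rewrite !normal_pdfE ?sqrtr_eq0 -?ltNge// /normal_peak /normal_fun sv sw.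
  rewrite !subr0.
  have -> : expR (- 2^-1 * ln (1 - 2 * (a * v))) =
      (Num.sqrt (1 - 2 * (a * v)))^-1.
    rewrite -powR12_sqrt ?ltW// -powRN /powR gt_eqF//.
  rewrite mulrCA [RHS]mulrA; congr (_ * _).
    rewrite /w -invfM -sqrtrM ?ltW//; congr (Num.sqrt _)^-1.
    by field; exact: lt0r_neq0.
  rewrite -expRD; congr expR; rewrite /w.
  by field; rewrite !lt0r_neq0.
rewrite ge0_integralZl//.
- by rewrite integral_normal_pdf mule1.
- by apply/measurable_EFinP; exact: measurable_normal_pdf.
- by move=> x _; rewrite lee_fin normal_pdf_ge0.
Qed.

(** Induction on the length: the law is the image of a product of the head law and the tail law, and
    Tonelli splits off the head factor. *)
Lemma tuple_prob_prod d (T : measurableType d) (R : realType) n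
    (P : 'I_n -> probability T R) (f : 'I_n -> T -> R) :
  (forall i, measurable_fun setT (f i)) -> (forall i x, 0 <= f i x) ->
  (\int[tuple_prob P]_t (\prod_i f i (tnth t i))%:E =
   \prod_i \int[P i]_x (f i x)%:E)%E.
Proof.
have mprod p (g : 'I_p -> T -> R) : (forall i, measurable_fun setT (g i)) ->
    measurable_fun setT (fun t : p.-tuple T => (\prod_i g i (tnth t i))%:E).
  move=> mg; apply/measurable_EFinP; apply: measurable_prod => i _.
  by apply: measurableT_comp => //; exact: measurable_tnth.
elim: n P f => [|n IHn] P f mf f0.
  rewrite big_ord0 /= integral_dirac//=; last exact: mprod.
  by rewrite diracT mul1e big_ord0.
rewrite big_ord_recl -IHn //=.
rewrite ge0_integral_pushforward//=; last 2 first.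
- exact: mprod.
- by move=> t _; rewrite lee_fin prodr_ge0.
rewrite preimage_setT.
have mc : measurable_fun setT (fun p : T * n.-tuple T =>
    (\prod_i f i (tnth (cons_pair p) i))%:E).
  by apply: (measurableT_comp (mprod _ _ mf)); exact: measurable_cons_pair.
rewrite (fubini_tonelli1 (fun p => (\prod_i f i (tnth (cons_pair p) i))%:E))//=;
  last by move=> p; rewrite lee_fin prodr_ge0.
rewrite /fubini_F.
have I0 : (0 <= \int[tuple_prob (fun i => P (lift ord0 i))]_t
    (\prod_i f (lift ord0 i) (tnth t i))%:E)%E.
  by apply: integral_ge0 => t _; rewrite lee_fin prodr_ge0.
rewrite -ge0_integralZr//; last 2 first.
- exact/measurable_EFinP.
- by move=> x _; rewrite lee_fin.
apply: eq_integral => x _.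
rewrite -ge0_integralZl//=; last 3 first.
- by apply: (mprod n (fun i => f (lift ord0 i))) => i; exact: mf.
- by move=> t _; rewrite lee_fin prodr_ge0.
- by rewrite lee_fin.
apply: eq_integral => t _; rewrite -EFinM big_ord_recl; congr (_ * _)%:E.
by apply: eq_bigr => i _; rewrite tnthS.
Qed.

Lemma measurable_mx_entry (R : realType) n (i j : 'I_n) :
  measurable_fun setT (fun X : 'M[R]_n => X i j : measurableTypeR R).
Proof.
move=> _ B mB; rewrite setTI; apply: sub_sigma_algebra.
by exists i, j, B.
Qed.

Lemma matrix_prob_prod (R : realType) n
    (P : 'I_n -> 'I_n -> probability (measurableTypeR R) R)
    (f : 'I_n * 'I_n -> R -> R) :
  (forall c, measurable_fun setT (f c)) -> (forall c x, 0 <= f c x) ->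
  (\int[matrix_prob P]_X (\prod_c f c (X c.1 c.2))%:E =
   \prod_c \int[P c.1 c.2]_x (f c x)%:E)%E.
Proof.
move=> mf f0; rewrite ge0_integral_pushforward//=; last 2 first.
- apply/measurable_EFinP; apply: measurable_prod => c _.
  by apply: measurableT_comp => //; exact: measurable_mx_entry.
- by move=> X _; rewrite lee_fin prodr_ge0.
rewrite preimage_setT (reindex (@enum_val _ {: 'I_n * 'I_n}))/=; last first.
  by exists enum_rank => ? _; rewrite ?enum_rankK ?enum_valK.
rewrite -(@tuple_prob_prod _ _ _ _ (fun l => P (enum_val l).1 (enum_val l).2)
  (fun l => f (enum_val l)))//; last by move=> l; exact: mf.
apply: eq_integral => t _; congr EFin.
rewrite (reindex (@enum_val _ {: 'I_n * 'I_n}))/=; last first.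
  by exists enum_rank => ? _; rewrite ?enum_rankK ?enum_valK.
by apply: eq_bigr => l _; rewrite mxE -surjective_pairing enum_valK.
Qed.

(** On [A] the exponential of t + sum a X^2 is at least 1, so its expectation, which factors over
    the cells, dominates the probability. The coefficients [a] may vary with the cell and have
    either sign, which covers upper and lower tails alike. *)
Lemma gaussian_chernoff (R : realType) n (v : 'I_n -> 'I_n -> R)
    (a : 'I_n * 'I_n -> R) (t : R) (A : set 'M[R]_n) :
  (forall i j, 0 < v i j) -> (forall c, 2 * (a c * v c.1 c.2) < 1) ->
  measurable A ->
  (forall X, A X -> 0 <= t + \sum_c a c * X c.1 c.2 ^+ 2) ->
  (centered_gaussian_law v A <=
   (expR (t - 2^-1 * \sum_c ln (1 - 2 * (a c * v c.1 c.2))))%:E)%E.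
Proof.
move=> v0 av mA At.
have mexp c : measurable_fun setT (fun x : R => expR (a c * x ^+ 2)).
  by apply: measurableT_comp => //; exact: measurable_funM.
have mint : measurable_fun setT
    (fun X : 'M[R]_n => (\prod_c expR (a c * X c.1 c.2 ^+ 2))%:E).
  apply/measurable_EFinP; apply: measurable_prod => c _.
  by apply: (measurableT_comp (mexp c)); exact: measurable_mx_entry.
rewrite -[X in centered_gaussian_law _ X]setIT -integral_indic//.
apply: (@le_trans _ _ (\int[centered_gaussian_law v]_X
    ((expR t)%:E * (\prod_c expR (a c * X c.1 c.2 ^+ 2))%:E))%E).
  apply: ge0_le_integral => //.
  - by apply/measurable_EFinP; exact: measurable_indic.
  - exact: emeasurable_funM.
  move=> X _; rewrite -EFinM lee_fin -expR_sum -expRD indicE.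
  have [XA|XA] := pselect (A X); last by rewrite memNset ?expR_ge0.
  rewrite mem_set//.
  by rewrite -[leLHS]expR0 ler_expR At.
rewrite ge0_integralZl//; last first.
  by move=> X _; rewrite lee_fin prodr_ge0// => c _; exact: expR_ge0.
rewrite (@matrix_prob_prod _ _ (fun i j => normal_prob 0 (Num.sqrt (v i j)))
  (fun c x => expR (a c * x ^+ 2)))//.
rewrite (eq_bigr (fun c =>
    (expR (- 2^-1 * ln (1 - 2 * (a c * v c.1 c.2))))%:E)); last first.
  by move=> c _; rewrite normal_prob_exp_square.
by rewrite prodEFin -EFinM -expR_sum -expRD -mulr_sumr mulNr.
Qed.

(** * Placements and variances *)

(** The rank of an element in [S] increases strictly along [S], so [coord] is injective on [S], and
    onto 'I_k by cardinality. The value 0 given to [None] never occurs on [S]. *)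
Lemma sum_coord (V : nmodType) k n (S : {set 'I_n}) (g : 'I_k -> V) :
  #|S| = k ->
  \sum_(i in S) oapp g 0 (Defs.coord k S i) = \sum_u g u.
Proof.
move=> Sk; pose r (i : 'I_n) := #|[set x in S | (x < i)%N]%SET|.
have coordE i u : Defs.coord k S i = Some u -> u = r i :> nat.
  by rewrite /Defs.coord /r; case: insubP => // w _ <- [->].
have r_mono (i j : 'I_n) : i \in S -> (i < j)%N -> (r i < r j)%N.
  move=> iS ij; apply/proper_card/properP; split.
    apply/fintype.subsetP => x; rewrite !inE => /andP[-> xi] /=.
    exact: ltn_trans xi ij.
  by exists i; rewrite !inE iS ?ij// ltnn.
have r_inj : {in S &, injective r}.
  move=> i j iS jS rij; apply/val_inj.
  by have [/(r_mono _ _ iS)|/(r_mono _ _ jS)|//] := ltngtP i j;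
    rewrite rij ltnn.
(* For k = 0 there is no default element of 'I_k from which to build a total coordinate map. *)
case: k => [|k] in g Sk coordE *.
  by rewrite (cards0_eq Sk) big_set0 big_ord0.
pose h (i : 'I_n) : 'I_k.+1 := odflt ord0 (Defs.coord k.+1 S i).
have coord_h i : i \in S -> Defs.coord k.+1 S i = Some (h i).
  by move=> iS; have [u uE] := coord_in Sk iS; rewrite /h uE.
have h_inj : {in S &, injective h}.
  move=> i j iS jS hij; apply: r_inj => //.
  by rewrite -(coordE _ _ (coord_h _ iS)) hij (coordE _ _ (coord_h _ jS)).
have hT : (h @: S = finset.setT)%SET.
  apply/eqP; rewrite eqEcard finset.subsetT /= cardsT card_ord.
  by rewrite card_in_imset ?Sk.
transitivity (\sum_(i in S) g (h i)).
  by apply: eq_bigr => i /coord_h ->.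
rewrite -(@big_imset _ _ _ _ _ h (mem S) g)//= hT.
by apply: eq_bigl => u; rewrite inE.
Qed.

Lemma mem_blocks k n (B : block n) :
  (B \in blocks k n) = (#|B.1| == k) && (#|B.2| == k).
Proof. by rewrite inE. Qed.

Lemma template_atE (R : realType) k n (S : 'M[R]_k) (B : block n) i j :
  B \in blocks k n -> (i, j) \in cells B ->
  exists u v, [/\ Defs.coord k B.1 i = Some u, Defs.coord k B.2 j = Some v
                & template_at S B i j = S u v].
Proof.
rewrite mem_blocks => /andP[/eqP B1 /eqP B2]; rewrite inE/= => /andP[iB jB].
have [u uE] := coord_in B1 iB; have [v vE] := coord_in B2 jB.
by exists u, v; rewrite /template_at uE vE.
Qed.

(** The coordinate map is a bijection from the cells of [B] onto the index pairs of the template.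
    Taking f as the identity yields [nu_det], and f(x) = x - ln (1 + x) yields [KL]. *)
Lemma sum_template (R : realType) (V : nmodType) k n (S : 'M[R]_k)
    (B : block n) (f : R -> V) : B \in blocks k n ->
  \sum_(c in cells B) f (template_at S B c.1 c.2) = \sum_u \sum_v f (S u v).
Proof.
move=> Bk; have := Bk; rewrite mem_blocks => /andP[/eqP B1 /eqP B2].
rewrite -(sum_coord _ B1).
transitivity (\sum_(i in B.1) \sum_(j in B.2) f (template_at S B i j)).
  by rewrite pair_big /=; apply: eq_bigl => c; rewrite inE.
apply: eq_bigr => i iB; have [u uE] := coord_in B1 iB; rewrite uE /=.
rewrite -(sum_coord _ B2); apply: eq_bigr => j jB.
have [v vE] := coord_in B2 jB.
by rewrite /template_at uE vE.
Qed.

Section H1_variance.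
Variables (R : realType) (k m n : nat) (Sigma : 'I_m -> 'M[R]_k).
Variables (F : {set block n}) (K : {set block n}).
Variable b : {ffun {B | B \in K} -> 'I_m}.
Hypotheses (Fk : F \subset blocks k n) (KF : K \in placements F m).
Hypothesis bK : b \in bijections m K.

Lemma placement_block (B : {B | B \in K}) : val B \in blocks k n.
Proof.
move: KF; rewrite inE => /and3P[KsF _ _].
by apply: (fintype.subsetP Fk); apply: (fintype.subsetP KsF); exact: valP.
Qed.

(** Disjointness of the blocks: a cell determines the block containing it, so the sum in
    [H1_variance] collapses to one term. *)
Lemma placement_inj (B B' : {B | B \in K}) c :
  c \in cells (val B) -> c \in cells (val B') -> B = B'.
Proof.
move=> cB cB'; apply/val_inj/eqP; apply: contraTT cB' => BB'.
move: KF; rewrite inE => /and3P[_ _ /forall_inP/(_ _ (valP B))].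
move=> /forall_inP/(_ _ (valP B'))/implyP/(_ BB').
by move=> /disjointFr/(_ cB) ->.
Qed.

Lemma bijections_bij : bijective b.
Proof.
move: bK; rewrite inE => /andP[/injectiveP b_inj /forallP b_onto].
apply: inj_card_bij => //; rewrite -(card_codom b_inj).
by apply/subset_leq_card/fintype.subsetP => l _; exact: b_onto.
Qed.

Lemma H1_variance_in (B : {B | B \in K}) i j : (i, j) \in cells (val B) ->
  H1_variance Sigma b i j = 1 + template_at (Sigma (b B)) (val B) i j.
Proof.
move=> ijB; rewrite /H1_variance (big_pred1 B)// => B'.
by apply/idP/eqP => [ijB'|->//]; exact: (placement_inj ijB' ijB).
Qed.

Lemma H1_variance_bounds (theta : R) : 0 <= theta ->
  (forall l u v, 0 <= Sigma l u v <= theta) ->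
  forall i j, 1 <= H1_variance Sigma b i j <= 1 + theta.
Proof.
move=> theta0 Stheta i j.
have [B ijB|noB] := pickP (fun B : {B | B \in K} => (i, j) \in cells (val B)).
  rewrite (H1_variance_in ijB) lerDl lerD2l.
  have [u [v [_ _ ->]]] := template_atE (Sigma (b B))
    (placement_block B) ijB.
  exact: Stheta.
by rewrite /H1_variance big_pred0// addr0 lexx lerDl.
Qed.

(** After exchanging the sums, each block contributes the total of its own template, and the
    bijection [b] counts every template exactly once. The result depends on neither [K] nor [b]. *)
Lemma sum_H1_variance :
  \sum_c (H1_variance Sigma b c.1 c.2 - 1) = nu_det Sigma.
Proof.
transitivity (\sum_c \sum_(B : {B | B \in K} | c \in cells (val B))
    template_at (Sigma (b B)) (val B) c.1 c.2).
  by apply: eq_bigr => -[i j] _; rewrite /H1_variance addrAC subrr add0r.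
rewrite (exchange_big_dep predT)//= /nu_det.
rewrite (reindex b) /=; last by apply: onW_bij; exact: bijections_bij.
apply: eq_bigr => B _.
exact: (sum_template _ id (placement_block B)).
Qed.

End H1_variance.

(** * Cardinalities of intervals, arcs and block families *)

Lemma card_interval n i k : (i + k <= n)%N ->
  #|[set x : 'I_n | (i <= x < i + k)%N]%SET| = k.
Proof.
move=> ikn; have lt_n (u : 'I_k) : (i + u < n)%N.
  by apply: leq_trans ikn; rewrite ltn_add2l.
rewrite -[RHS]card_ord -(@card_imset _ _ (fun u => Ordinal (lt_n u))).
  apply: eq_card => x; rewrite inE; apply/andP/imsetP => [[ix xik]|[u _ ->]/=].
    have ux : (x - i < k)%N by rewrite ltn_subLR.
    by exists (Ordinal ux) => //; apply/val_inj; rewrite /= subnKC.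
  by rewrite leq_addr ltn_add2l.
by move=> u v [/eqP]; rewrite eqn_add2l => /eqP/val_inj.
Qed.

(** Since k <= n, the shifts i + u with u < k are distinct modulo n, so the arc does not overlap
    itself. *)
Lemma card_arc n i k : (k <= n)%N ->
  #|[set x : 'I_n | [exists j : 'I_k, (x == (i + j) %% n :> nat)%N]]%SET| = k.
Proof.
case: n => [|n] kn.
  by move: kn; rewrite leqn0 => /eqP ->; apply: eq_card0 => -[].
have lt_n (u : 'I_k) : ((i + u) %% n.+1 < n.+1)%N by rewrite ltn_pmod.
rewrite -[RHS]card_ord -(@card_imset _ _ (fun u => Ordinal (lt_n u))).
  apply: eq_card => x; rewrite inE; apply/existsP/imsetP.
    by move=> [u /eqP xu]; exists u => //; exact/val_inj.
  by move=> [u _ ->]; exists u.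
move=> u v [/eqP]; rewrite eqn_modDl !modn_small ?(leq_trans (ltn_ord _) kn)//.
by move=> /eqP/val_inj.
Qed.

Lemma con_blocks_sub k n : (k <= n)%N -> con_blocks k n \subset blocks k n.
Proof.
move=> kn; apply/fintype.subsetP => -[S T]; rewrite inE mem_blocks /=.
move=> /andP[/imsetP[i _ ->] /imsetP[j _ ->]].
have le_n (l : 'I_(n - k).+1) : (l + k <= n)%N.
  by have := ltn_ord l; rewrite ltnS leq_subRL // addnC.
by rewrite !card_interval ?eqxx.
Qed.

Lemma circ_blocks_sub k n : (k <= n)%N -> circ_blocks k n \subset blocks k n.
Proof.
move=> kn; apply/fintype.subsetP => -[S T]; rewrite inE mem_blocks /=.
move=> /andP[/imsetP[i _ ->] /imsetP[j _ ->]].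
by rewrite !card_arc ?eqxx.
Qed.

Lemma card_blocks k n : #|blocks k n| = ('C(n, k) ^ 2)%N.
Proof.
rewrite -[n in 'C(n, k)]card_ord -card_draws expnS expn1 -cardsX.
by apply: eq_card => -[S T]; rewrite !inE.
Qed.

(** There are at most n - k + 1 intervals, hence at most n because k > 0. *)
Lemma card_con_blocks k n : (0 < k <= n)%N -> (#|con_blocks k n| <= n ^ 2)%N.
Proof.
move=> /andP[k0 kn]; rewrite cardsX expnS expn1.
have le_n : (#|intervals k n| <= n)%N.
  apply: leq_trans (leq_imset_card _ _) _; rewrite card_ord.
  by rewrite -subSn// leq_subLR -addn1 addnC leq_add2r.
exact: leq_mul.
Qed.

Lemma card_circ_blocks k n : (#|circ_blocks k n| <= n ^ 2)%N.
Proof.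
rewrite cardsX expnS expn1.
have le_n : (#|arcs k n| <= n)%N.
  by apply: leq_trans (leq_imset_card _ _) _; rewrite card_ord.
exact: leq_mul.
Qed.

(** * Logarithm bounds and the union bound *)

(** This is ln z <= z - 1 applied to z = 1 / (1 + x). *)
Lemma ln1Dx_ge (R : realType) (x : R) : -1 < x -> x / (1 + x) <= ln (1 + x).
Proof.
move=> x1; have d0 : 0 < 1 + x by rewrite -ltrBlDl sub0r.
have /le_ln1Dx : -1 < (1 + x)^-1 - 1 by rewrite ltrBrDr addNr invr_gt0.
rewrite addrC subrK lnV ?posrE// lerNl; apply: le_trans.
by rewrite le_eqVlt; apply/orP; left; apply/eqP; field; exact: lt0r_neq0.
Qed.

(** The left side is the logarithm of the Bhattacharyya coefficient of N(0, 1) and N(0, 1 + s). It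
    equals - ln (1 + y) / 4 with the [y] below; the constant is 36 = 4 * 9, from ln (1 + y) >= s^2 /
    9 and s - ln (1 + s) <= s^2. *)
Lemma half_llr_bound (R : realType) (s : R) : 0 <= s <= 1 ->
  4^-1 * ln (1 + s) - 2^-1 * ln (1 + 2^-1 * s) <= - (36^-1 * (s - ln (1 + s))).
Proof.
move=> /andP[s0 s1]; have d0 : 0 < 1 + s by lra.
have h0 : 0 < 1 + 2^-1 * s by lra.
(* (1 + s / 2) ^ 2 = (1 + s) (1 + y) *)
pose y := s ^+ 2 / (4 * (1 + s)).
have y0 : 0 <= y by rewrite divr_ge0 ?sqr_ge0//; lra.
have lny : ln (1 + y) = 2 * ln (1 + 2^-1 * s) - ln (1 + s).
  rewrite (_ : 1 + y = (1 + 2^-1 * s) ^+ 2 / (1 + s)); last first.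
    by rewrite /y; field; exact: lt0r_neq0.
  by rewrite ln_div ?posrE ?exprn_gt0// lnXn// mulr_natl.
(* The denominator is (2 + s)^2, at most 9 for s <= 1. *)
have y9 : s ^+ 2 / 9 <= ln (1 + y).
  apply: le_trans (ln1Dx_ge _); last by lra.
  have -> : y / (1 + y) = s ^+ 2 / (4 * (1 + s) + s ^+ 2).
    by rewrite /y; field; rewrite !lt0r_neq0//; nra.
  apply: ler_wpM2l; first exact: sqr_ge0.
  by rewrite lef_pV2 ?posrE; nra.
have lns : s - ln (1 + s) <= s ^+ 2.
  have : s / (1 + s) <= ln (1 + s) by apply: ln1Dx_ge; lra.
  have : s - s / (1 + s) <= s ^+ 2; last by lra.
  have -> : s - s / (1 + s) = s ^+ 2 / (1 + s) by field; exact: lt0r_neq0.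
  by rewrite ler_pdivrMr//; nra.
lra.
Qed.

Lemma measurable_superlevel d (T : measurableType d) (R : realType)
    (f : T -> R) (r : R) :
  measurable_fun setT f -> measurable [set x | r <= f x].
Proof.
move=> mf; rewrite (_ : [set x | _] = setT `&` f @^-1` `[r, +oo[).
  exact: mf.
by rewrite setTI; apply/seteqP; split => x; rewrite /= in_itv/= andbT.
Qed.

Section finite_union.
Context d (T : measurableType d) (R : realType) (P : probability T R).
Variables (I : finType) (D : {pred I}) (A : I -> set T).
Hypothesis mA : forall i, measurable (A i).

(** Measurability is carried through the same induction because subadditivity at each step requires
    it. *)
Let seq_union (s : seq I) :
  measurable [set x | exists2 i, i \in s & A i x] /\
  (P [set x | exists2 i, i \in s & A i x] <= \sum_(i <- s) P (A i))%E.
Proof.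
elim: s => [|i s [mIH IH]].
  rewrite (_ : [set x | _] = set0); last by apply/seteqP; split => x [].
  by rewrite big_nil measure0.
rewrite (_ : [set x | _] = A i `|` [set x | exists2 j, j \in s & A j x]).
  split; first exact: measurableU.
  rewrite big_cons; apply: le_trans (leeD2l _ IH).
  exact: measureU2.
apply/seteqP; split => x /=.
  move=> [j]; rewrite inE => /predU1P[->|js] Ajx; first by left.
  by right; exists j.
by move=> [Aix|[j js Ajx]]; [exists i|exists j]; rewrite ?inE ?eqxx ?js ?orbT.
Qed.

Let enum_union : [set x | exists2 i, D i & A i x] =
  [set x | exists2 i, i \in enum D & A i x].
Proof.
by apply/seteqP; split => x /= [i iD Aix]; exists i => //;
  move: iD; rewrite mem_enum.
Qed.

Lemma probability_finite_union :
  (P [set x | exists2 i, D i & A i x] <= \sum_(i in D) P (A i))%E.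
Proof. by rewrite enum_union -big_enum; have [] := seq_union (enum D). Qed.

End finite_union.

(** * Risk *)

Lemma uniform_average_ge0 (R : realType) (T : finType) (E : {set T})
    (f : T -> \bar R) :
  (forall x, x \in E -> 0 <= f x)%E -> (0 <= uniform_average E f)%E.
Proof.
move=> f0; apply: mule_ge0; first by rewrite lee_fin invr_ge0.
exact: sume_ge0.
Qed.

(** An average over the empty set is 0, as the inverse of 0 is 0; this case rests on [0 <= r]. *)
Lemma uniform_average_le (R : realType) (T : finType) (E : {set T})
    (f : T -> \bar R) (r : R) : 0 <= r ->
  (forall x, x \in E -> f x <= r%:E)%E -> (uniform_average E f <= r%:E)%E.
Proof.
move=> r0 fr; rewrite /uniform_average.
apply: (@le_trans _ _ ((#|E|%:R^-1)%:E * \sum_(x in E) r%:E)%E).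
  by apply: lee_wpmul2l; [rewrite lee_fin invr_ge0|exact: lee_sum].
rewrite sumEFin sumr_const -EFinM lee_fin -[r *+ _]mulr_natl mulrA.
have [->|E0] := eqVneq (#|E|%:R : R) 0; first by rewrite mulr0 mul0r.
by rewrite mulVf// mul1r.
Qed.

Section risk.
Context (R : realType) (k m n : nat).
Implicit Types (Sigma : 'I_m -> 'M[R]_k) (F K : {set block n}).

(** A bound uniform in the placement and the bijection survives both averages, so the mixture need
    not be computed. *)
Lemma H1_law_le Sigma F (A : set 'M[R]_n) (r : R) : 0 <= r ->
  (forall K (b : {ffun {B | B \in K} -> 'I_m}),
     K \in placements F m -> b \in bijections m K ->
     centered_gaussian_law (H1_variance Sigma b) A <= r%:E)%E ->
  (H1_law Sigma F A <= r%:E)%E.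
Proof.
move=> r0 Ar; apply: uniform_average_le => // K KF.
by apply: uniform_average_le => // b bK; exact: Ar.
Qed.

Lemma risk_ge0 Sigma F (test : 'M[R]_n -> bool) : (0 <= risk Sigma F test)%E.
Proof.
apply: adde_ge0; first exact: measure_ge0.
apply: uniform_average_ge0 => K _; apply: uniform_average_ge0 => b _.
exact: measure_ge0.
Qed.

Lemma template_at_bounds (S : 'M[R]_k) (B : block n) i j (theta : R) :
  0 <= theta -> (forall u v, 0 <= S u v <= theta) ->
  0 <= template_at S B i j <= theta.
Proof.
move=> theta0 S0; rewrite /template_at.
by case: (Defs.coord k B.1 i) => [u|]; case: (Defs.coord k B.2 j) => [v|];
  rewrite ?lexx.
Qed.

Lemma measurable_mx_quadratic (I : Type) (r : seq I) (p : I -> 'I_n * 'I_n)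
    (a b : I -> R) :
  measurable_fun setT (fun X : 'M[R]_n =>
    \sum_(c <- r) (a c * X (p c).1 (p c).2 ^+ 2 + b c)).
Proof.
apply: measurable_sum => c; apply: measurable_funD => //.
apply: measurable_funM => //; apply: measurable_funX.
exact: measurable_mx_entry.
Qed.

Lemma measurable_quad_test Sigma :
  measurable [set X : 'M[R]_n | quad_test Sigma X].
Proof.
apply: measurable_superlevel.
under eq_fun do rewrite pair_bigA /=.
have := measurable_mx_quadratic (index_enum _) id (fun=> 1) (fun=> -1).
by congr (measurable_fun _ _); apply/funext => X; apply: eq_bigr => c _;
  rewrite mul1r.
Qed.

End risk.

(** * The quadratic test *)

Section quad.
Context (R : realType) (k m n : nat).
Variables (Sigma : 'I_m -> 'M[R]_k) (F : {set block n}).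
Hypotheses (n4 : (4 <= n)%N) (Fk : F \subset blocks k n).
Hypothesis S01 : forall l u v, 0 <= Sigma l u v <= 1.

Let N : R := n%:R.

Let Nge4 : 4 <= N.
Proof. by rewrite ler_nat. Qed.

Let card_cells : #|{: 'I_n * 'I_n}|%:R = N * N.
Proof. by rewrite card_prod card_ord natrM. Qed.

Lemma quad_testE (X : 'M[R]_n) :
  quad_test Sigma X = (nu_det Sigma / 2 + N * N <= \sum_c X c.1 c.2 ^+ 2).
Proof.
rewrite /quad_test pair_bigA /= sumrB sumr_const -[1 *+ _]/(_%:R) card_cells.
by rewrite lerBrDr.
Qed.

Lemma quad_test_H0 :
  (H0_law R n [set X | quad_test Sigma X = true] <=
   (expR (8 - nu_det Sigma / (2 * N)))%:E)%E.
Proof.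
have N4 := Nge4; have N0 : 0 < N by lra.
have iN : N^-1 <= 4^-1 by rewrite lef_pV2 ?posrE.
pose a : 'I_n * 'I_n -> R := fun=> N^-1.
pose t := - (nu_det Sigma / (2 * N) + N).
apply: le_trans (@gaussian_chernoff _ _ _ a t _ _ _ _ _) _ => //.
- by move=> c; rewrite /a mulr1; lra.
- exact: measurable_quad_test.
- move=> X /= /[!quad_testE] qX; rewrite -mulr_sumr /t addrC subr_ge0.
  rewrite [leRHS]mulrC ler_pdivlMr//; apply: le_trans qX.
  by rewrite le_eqVlt; apply/orP; left; apply/eqP; field; exact: lt0r_neq0.
rewrite lee_fin ler_expR /a mulr1 sumr_const -[_ *+ #|_|]mulr_natl card_cells.
have lb : - (2 / (N - 2)) <= ln (1 - 2 * N^-1).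
  apply: le_trans (ln1Dx_ge _); last by lra.
  rewrite le_eqVlt; apply/orP; left; apply/eqP; field.
  by rewrite !lt0r_neq0//; lra.
have : N * N * - (2 / (N - 2)) <= N * N * ln (1 - 2 * N^-1).
  by rewrite ler_pM2l// mulr_gt0.
(* After clearing the denominator this is exactly n >= 4. The null error thus has additive constant
   4; the 8 in the statement is the one shared with the alternative. *)
have : N * N * (2 / (N - 2)) <= 2 * N + 8; last by rewrite /t; lra.
by rewrite mulrA ler_pdivrMr; nra.
Qed.

(** To first order, the cells contribute - (nu / n + n) to the exponent, while the threshold
    contributes nu / (2 n) + n. The second-order loss of 8 / n^2 per cell totals 8. *)
Lemma quad_test_H1 :
  (H1_law Sigma F [set X | quad_test Sigma X = false] <=
   (expR (8 - nu_det Sigma / (2 * N)))%:E)%E.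
Proof.
have N4 := Nge4; have N0 : 0 < N by lra.
have iN : N^-1 <= 4^-1 by rewrite lef_pV2 ?posrE.
have iN0 : 0 < N^-1 by rewrite invr_gt0.
apply: H1_law_le => [|K b KF bK]; first exact: expR_ge0.
set v := H1_variance Sigma b.
have v12 i j : 1 <= v i j <= 1 + 1.
  by apply: (H1_variance_bounds b Fk KF ler01 S01).
pose a : 'I_n * 'I_n -> R := fun=> - N^-1.
pose t := nu_det Sigma / (2 * N) + N.
apply: le_trans (@gaussian_chernoff _ _ v a t _ _ _ _ _) _ => //.
- by move=> i j; have /andP[] := v12 i j; lra.
- by move=> c; have /andP[] := v12 c.1 c.2; rewrite /a; nra.
- rewrite (_ : [set X | _] = ~` [set X : 'M[R]_n | quad_test Sigma X]).
    by apply: measurableC; exact: measurable_quad_test.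
  by apply/seteqP; split => X /=; [move=> ->|move/negP/negbTE].
- move=> X /= /negbT; rewrite quad_testE -ltNge => /ltW qX.
  rewrite -mulr_sumr /t mulNr subr_ge0 [leLHS]mulrC ler_pdivrMr//.
  apply: le_trans qX _.
  by rewrite le_eqVlt; apply/orP; left; apply/eqP; field; exact: lt0r_neq0.
rewrite lee_fin ler_expR.
(* With z = 2 v / n <= 4 / n one has ln (1 + z) >= z / (1 + z) >= z - z^2. The term z is split into
   2 (v - 1) / n + 2 / n so that [sum_H1_variance] evaluates its sum. *)
have lb c : 2 * N^-1 * (v c.1 c.2 - 1) + 2 * N^-1 - 16 * (N^-1 * N^-1) <=
    ln (1 - 2 * (a c * v c.1 c.2)).
  have /andP[v1 v2] := v12 c.1 c.2; rewrite /a.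
  set y := N^-1 in iN iN0 *; set w := v c.1 c.2 in v1 v2 *.
  have -> : 1 - 2 * (- y * w) = 1 + 2 * y * w by ring.
  have yw0 : 0 <= 2 * y * w by nra.
  apply: le_trans (ln1Dx_ge _); last by lra.
  have yw4 : 2 * y * w <= 4 * y by nra.
  have yw16 : (2 * y * w) ^+ 2 <= 16 * (y * y) by nra.
  by rewrite ler_pdivlMr; nra.
have : \sum_(c : 'I_n * 'I_n)
    (2 * N^-1 * (v c.1 c.2 - 1) + 2 * N^-1 - 16 * (N^-1 * N^-1)) <=
    \sum_c ln (1 - 2 * (a c * v c.1 c.2)).
  by apply: ler_sum => c _; exact: lb.
rewrite sumrB big_split /= -mulr_sumr (sum_H1_variance Sigma Fk KF bK).
rewrite !sumr_const -(mulr_natl (2 * N^-1)) -(mulr_natl (16 * _)) card_cells.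
rewrite (_ : N * N * (2 * N^-1) = 2 * N); last by field; exact: lt0r_neq0.
rewrite (_ : N * N * (16 * (N^-1 * N^-1)) = 16); last first.
  by field; exact: lt0r_neq0.
rewrite /t invfM; set y := N^-1; set S := \sum_c _; set nu := nu_det _.
lra.
Qed.

End quad.

(** * The scan test *)

Section scan.
Context (R : realType) (k m n : nat).
Implicit Types (S : 'M[R]_k) (B : block n) (X : 'M[R]_n).

(** Log-likelihood ratio, against the null, of the law with template [S] planted on [B]; [scan_stat]
    is its maximum over blocks. *)
Definition block_llr S B X : R :=
  \sum_(c in cells B)
    let s := template_at S B c.1 c.2 in
    2^-1 * (s / (1 + s) * X c.1 c.2 ^+ 2 - ln (1 + s)).

(** The base value -oo of both maxima lies below the finite [tau], so rejection always has a
    witness. *)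
Lemma scan_testE (Sigma : 'I_m -> 'M[R]_k) (F : {set block n}) tau X :
  scan_test Sigma F tau X <->
  exists2 p : 'I_m * block n, p.2 \in F & tau <= block_llr (Sigma p.1) p.2 X.
Proof.
rewrite /scan_test; split=> [/bigmax_geP[|[l _ /bigmax_geP[|[B BF]]]]|].
- by rewrite leeNy_eq.
- by rewrite leeNy_eq.
- by rewrite lee_fin => tauB; exists (l, B).
move=> [[l B]/= BF tauB]; apply/bigmax_geP; right; exists l => //.
by apply/bigmax_geP; right; exists B => //; rewrite lee_fin.
Qed.

Lemma measurable_block_llr S B : measurable_fun setT (block_llr S B).
Proof.
have := measurable_mx_quadratic (enum (cells B)) id
  (fun c => 2^-1 * (template_at S B c.1 c.2 / (1 + template_at S B c.1 c.2)))
  (fun c => - (2^-1 * ln (1 + template_at S B c.1 c.2))).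
congr (measurable_fun _ _); apply/funext => X.
rewrite /block_llr -big_enum; apply: eq_bigr => c _ /=.
by ring.
Qed.

Lemma scan_test_set (Sigma : 'I_m -> 'M[R]_k) (F : {set block n}) tau :
  [set X | scan_test Sigma F tau X = true] =
  [set X | exists2 p : 'I_m * block n, p.2 \in F &
     tau <= block_llr (Sigma p.1) p.2 X].
Proof. by apply/seteqP; split => X /scan_testE. Qed.

Lemma measurable_scan_test (Sigma : 'I_m -> 'M[R]_k) (F : {set block n}) tau :
  measurable [set X | scan_test Sigma F tau X = true].
Proof.
rewrite scan_test_set.
apply: (@fin_bigcup_measurable _ _ _ [set p : 'I_m * block n | p.2 \in F]
  (fun p => [set X | tau <= block_llr (Sigma p.1) p.2 X])) => [|p _].
  exact: finite_finset.
by apply: measurable_superlevel; exact: measurable_block_llr.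
Qed.

(* Under H0 the exponential of the block statistic is a likelihood ratio, hence
   has expectation 1. *)
Lemma block_llr_H0 S B tau : (forall u v, 0 <= S u v <= 1) ->
  (H0_law R n [set X | (tau <= block_llr S B X)%R] <= (expR (- tau))%:E)%E.
Proof.
move=> S01; pose s c := template_at S B c.1 c.2.
have s01 c : 0 <= s c <= 1 by exact: template_at_bounds.
pose a c := if c \in cells B then 2^-1 * (s c / (1 + s c)) else 0.
pose t := - tau - 2^-1 * \sum_(c in cells B) ln (1 + s c).
(* As 1 - s / (1 + s) = 1 / (1 + s), the Gaussian moments will cancel the logarithms in [t]
   exactly. *)
have a2 c : 1 - 2 * (a c * 1) = if c \in cells B then (1 + s c)^-1 else 1.
  have /andP[s0 s1] := s01 c; rewrite /a; case: ifP => _; last by ring.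
  by field; rewrite lt0r_neq0//; lra.
apply: le_trans (@gaussian_chernoff _ _ _ a t _ _ _ _ _) _ => //.
- move=> c; rewrite -subr_gt0 a2; case: ifP => // _.
  by have /andP[s0 s1] := s01 c; rewrite invr_gt0; lra.
- by apply: measurable_superlevel; exact: measurable_block_llr.
- move=> X /= tauX.
  suff -> : t + \sum_c a c * X c.1 c.2 ^+ 2 = block_llr S B X - tau.
    by rewrite subr_ge0.
  rewrite (bigID (mem (cells B))) /= [X in _ + (_ + X)]big1 ?addr0; last first.
    by move=> c /negbTE cB; rewrite /a cB mul0r.
  rewrite /t [RHS]addrC -addrA; congr (_ + _).
  rewrite mulr_sumr -sumrN -big_split /=.
  by apply: eq_bigr => c cB; rewrite /a cB -/(s c); ring.
rewrite lee_fin ler_expR.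
under eq_bigr do rewrite a2.
rewrite [X in _ - _ * X](bigID (mem (cells B))) /=.
rewrite [X in _ - _ * (_ + X)]big1 ?addr0; last first.
  by move=> c /negbTE ->; rewrite ln1.
rewrite (eq_bigr (fun c => - ln (1 + s c))); last first.
  move=> c ->; have /andP[s0 s1] := s01 c.
  by rewrite lnV// posrE; lra.
by rewrite sumrN /t mulrN opprK subrK.
Qed.

Lemma scan_test_H0 (Sigma : 'I_m -> 'M[R]_k) (F : {set block n}) tau :
  (forall l u v, 0 <= Sigma l u v <= 1) ->
  (H0_law R n [set X | scan_test Sigma F tau X = true] <=
   (m%:R * #|F|%:R * expR (- tau))%:E)%E.
Proof.
move=> S01; rewrite scan_test_set.
apply: le_trans (@probability_finite_union _ _ _ (H0_law R n) _
  (fun p : 'I_m * block n => p.2 \in F)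
  (fun p => [set X | tau <= block_llr (Sigma p.1) p.2 X]) _) _.
  by move=> p; apply: measurable_superlevel; exact: measurable_block_llr.
apply: (@le_trans _ _
    (\sum_(p in [pred p : 'I_m * block n | p.2 \in F]) (expR (- tau))%:E)%E).
  by apply: lee_sum => p _; exact: block_llr_H0.
rewrite sumEFin sumr_const -[_ *+ _]mulr_natl -natrM lee_fin.
rewrite ler_pM2r ?expR_gt0// ler_nat -[X in (_ <= X * _)%N]card_ord -cardsT.
rewrite -cardsX; apply/subset_leq_card/fintype.subsetP => p.
by rewrite !inE.
Qed.

Lemma KL_ge0 S : (forall u v, 0 <= S u v) -> 0 <= KL S.
Proof.
move=> S0; rewrite mulr_ge0 ?invr_ge0//; apply: sumr_ge0 => u _.
apply: sumr_ge0 => v _; rewrite subr_ge0 le_ln1Dx//.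
exact: lt_le_trans (S0 u v).
Qed.

(** If the maximum is only the base value 0, any template serves, since [KL] is nonnegative and m >
    0. *)
Lemma max_KL_le (Sigma : 'I_m -> 'M[R]_k) : (0 < m)%N ->
  (forall l u v, 0 <= Sigma l u v) ->
  exists l, max_KL Sigma <= KL (Sigma l).
Proof.
move=> m0 S0; have : max_KL Sigma <= max_KL Sigma by [].
move/bigmax_geP => -[M0|[l _ Ml]]; last by exists l.
exists (Ordinal m0); apply: le_trans M0 _.
exact: KL_ge0.
Qed.

Lemma scan_test_H1 (Sigma : 'I_m -> 'M[R]_k) (F : {set block n}) tau :
  (0 < m)%N ->
  F \subset blocks k n -> (forall l u v, 0 <= Sigma l u v <= 1) ->
  (H1_law Sigma F [set X | scan_test Sigma F tau X = false] <=
   (expR (tau / 2 - max_KL Sigma / 18))%:E)%E.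
Proof.
move=> m0 Fk S01.
have S0 l u v : 0 <= Sigma l u v by have /andP[] := S01 l u v.
apply: H1_law_le => [|K b KF bK]; first exact: expR_ge0.
have [l lmax] := max_KL_le m0 S0.
(* The inverse of [b] locates the block on which template [l] is planted. *)
have [g bg gb] := bijections_bij bK.
pose B := val (g l); have Bk : B \in blocks k n := placement_block Fk KF (g l).
have BF : B \in F.
  move: KF; rewrite inE => /and3P[KsF _ _].
  by apply: (fintype.subsetP KsF); exact: valP.
set v := H1_variance Sigma b.
pose s c := template_at (Sigma l) B c.1 c.2.
have s01 c : 0 <= s c <= 1 by exact: template_at_bounds.
have vB c : c \in cells B -> v c.1 c.2 = 1 + s c.
  by case: c => i j ijB; rewrite /v (H1_variance_in Sigma b KF ijB) gb.
have v12 i j : 1 <= v i j <= 1 + 1.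
  by apply: (H1_variance_bounds b Fk KF ler01 S01).
(* Half of tau minus the block statistic: [a] holds its quadratic coefficients and [t] the remaining
   constants. Below, v = 1 + s cancels the denominator of [a]. *)
pose a c := if c \in cells B then - (4^-1 * (s c / (1 + s c))) else 0.
pose t := tau / 2 + 4^-1 * \sum_(c in cells B) ln (1 + s c).
have a2 c : 1 - 2 * (a c * v c.1 c.2) =
    if c \in cells B then 1 + 2^-1 * s c else 1.
  have /andP[s0 s1] := s01 c; rewrite /a; case: ifP => cB; last by ring.
  by rewrite vB//; field; rewrite lt0r_neq0//; lra.
apply: le_trans (@gaussian_chernoff _ _ v a t _ _ _ _ _) _ => //.
- by move=> i j; have /andP[v1 v2] := v12 i j; lra.
- move=> c; rewrite -subr_gt0 a2; case: ifP => // _.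
  by have /andP[s0 s1] := s01 c; lra.
- rewrite (_ : [set X | _] = ~` [set X | scan_test Sigma F tau X = true]).
    by apply: measurableC; exact: measurable_scan_test.
  by apply/seteqP; split => X /=; [move=> -> |move/negP/negbTE].
- move=> X /= /negbT/negP/scan_testE noX.
  have /ltW llrX : block_llr (Sigma l) B X < tau.
    by rewrite ltNge; apply/negP => tauX; apply: noX; exists (l, B).
  suff -> : t + \sum_c a c * X c.1 c.2 ^+ 2 =
      2^-1 * (tau - block_llr (Sigma l) B X) by rewrite mulr_ge0 ?subr_ge0.
  rewrite (bigID (mem (cells B))) /= [X in _ + (_ + X)]big1 ?addr0; last first.
    by move=> c /negbTE cB; rewrite /a cB mul0r.
  rewrite mulrBr /t [_ * tau]mulrC -addrA; congr (_ + _).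
  rewrite !mulr_sumr -big_split -sumrN /=.
  apply: eq_bigr => c cB; rewrite /a cB -/(s c).
  by set q := s c / (1 + s c); field.
rewrite lee_fin ler_expR.
under eq_bigr do rewrite a2.
rewrite [X in _ - _ * X](bigID (mem (cells B))) /=.
rewrite [X in _ - _ * (_ + X)]big1 ?addr0; last first.
  by move=> c /negbTE ->; rewrite ln1.
rewrite (eq_bigr (fun c => ln (1 + 2^-1 * s c))); last by move=> c ->.
rewrite /t -addrA lerD2l !mulr_sumr -sumrB.
apply: (@le_trans _ _ (\sum_(c in cells B) - (36^-1 * (s c - ln (1 + s c))))).
  by apply: ler_sum => c _; exact: half_llr_bound.
(* The sum of s - ln (1 + s) over the template is 2 KL, which turns 36 into 18. *)
rewrite sumrN lerN2 -mulr_sumr.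
rewrite (sum_template (Sigma l) (fun x => x - ln (1 + x)) Bk).
move: lmax; rewrite /KL; set T := \sum_u _; lra.
Qed.

End scan.

(** * Asymptotics *)

(** The bound C(n, k) <= (e n / k)^k, from C(n, k) (k / n)^k <= (1 + k / n)^n <= e^k. *)
Lemma bin_le_expR (R : realType) (k n : nat) : (0 < k <= n)%N ->
  'C(n, k)%:R <= expR (k%:R * ln (expR 1 * n%:R / k%:R)) :> R.
Proof.
move=> /andP[k0 kn]; have n0 := leq_trans k0 kn.
have kR : 0 < k%:R :> R by rewrite ltr0n.
have nR : 0 < n%:R :> R by rewrite ltr0n.
pose x : R := k%:R / n%:R; have x0 : 0 < x by rewrite divr_gt0.
have xk0 : 0 < x ^+ k by rewrite exprn_gt0.
(* one term of the binomial expansion of (1 + k / n) ^ n *)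
have binx : 'C(n, k)%:R * x ^+ k <= expR k%:R.
  apply: (@le_trans _ _ ((1 + x) ^+ n)).
    rewrite exprDn (bigD1 (inord k)) //= inordK ?ltnS// expr1n mul1r.
    rewrite mulr_natl lerDl; apply: sumr_ge0 => i _.
    by rewrite mulrn_wge0// mulr_ge0// exprn_ge0// ltW.
  apply: (@le_trans _ _ (expR x ^+ n)).
    by rewrite lerXn2r ?nnegrE ?expR_ge0 ?expR_ge1Dx// addr_ge0// ltW.
  by rewrite -expRM_natl /x mulrC divfK// lt0r_neq0.
rewrite -(ler_pM2r xk0); apply: le_trans binx _.
rewrite -[x]lnK ?posrE// -expRM_natl -expRD ler_expR -mulrDr.
rewrite -lnM ?posrE ?divr_gt0 ?mulr_gt0 ?expR_gt0//.
have -> : expR 1 * n%:R / k%:R * x = expR 1.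
  by rewrite /x; field; rewrite !lt0r_neq0.
by rewrite expRK mulr1.
Qed.

(** The right side is k (ln n - ln k) + k, where the product is at least ln n - ln k and k > ln k.
    It makes the scan threshold diverge whatever the growth of k. *)
Lemma ln_le_block_entropy (R : realType) (k n : nat) : (0 < k <= n)%N ->
  ln n%:R <= k%:R * ln (expR 1 * n%:R / k%:R) :> R.
Proof.
move=> /andP[k0 kn]; have n0 := leq_trans k0 kn.
have kR : 0 < k%:R :> R by rewrite ltr0n.
have nR : 0 < n%:R :> R by rewrite ltr0n.
have k1 : 1 <= k%:R :> R by rewrite ler1n.
rewrite -mulrA lnM ?posrE ?expR_gt0 ?divr_gt0// expRK ln_div ?posrE//.
have lnkn : ln k%:R <= ln n%:R :> R by rewrite ler_ln ?posrE// ler_nat.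
have lnk : ln k%:R < k%:R :> R := ln_sublinear kR.
nra.
Qed.

Lemma cvg_ln_natr (R : realType) :
  ln n%:R @[n --> \oo] --> (+oo : set_system R).
Proof.
apply/cvgryPge => A; apply: filterS (nbhs_infty_ger (expR A)) => n An.
by rewrite -[A]expRK ler_ln ?posrE ?expR_gt0// (lt_le_trans (expR_gt0 A)).
Qed.

Lemma cvg_expR_bound (R : realType) (r : nat -> \bar R) (u w : nat -> R) :
  (forall n, 0 <= r n)%E ->
  (\forall n \near \oo, (r n <= (expR (- u n) + expR (- w n))%:E)%E) ->
  u n @[n --> \oo] --> +oo -> w n @[n --> \oo] --> +oo ->
  r n @[n --> \oo] --> 0%E.
Proof.
move=> r0 ruw uoo woo.
apply: (@squeeze_cvge _ _ _ _ (fun=> 0%E) _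
  (fun n => (expR (- u n) + expR (- w n))%:E)); last 2 first.
- exact: cvg_cst.
- apply: cvg_EFin; first exact: nearW.
  rewrite -[0](addr0 (0 : R)); apply: cvgD.
    exact: (@cvg_comp _ _ _ u (fun x : R => expR (- x)) _ _ _
      uoo (@cvgr_expR R)).
  exact: (@cvg_comp _ _ _ w (fun x : R => expR (- x)) _ _ _
      woo (@cvgr_expR R)).
by apply: filterS ruw => n ->; rewrite r0.
Qed.

(** * Vanishing risks for a general block family *)

Section asymptotics.
Context (R : realType) (k m : nat -> nat).
Variables (Sigma : forall n, 'I_(m n) -> 'M[R]_(k n)).
Variable F : forall n, {set block n}.
Hypothesis Hkm : forall n, (0 < n)%N ->
  [/\ (0 < k n)%N, (0 < m n)%N & (k n <= n)%N].
Hypothesis S01 : forall n, (0 < n)%N -> forall l u v, 0 <= @Sigma n l u v <= 1.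
Hypothesis Fk : forall n, (0 < n)%N -> F n \subset blocks (k n) n.

Lemma quad_risk_cvg0 : is_omega (fun n => nu_det (@Sigma n)) (fun n => n%:R) ->
  risk (@Sigma n) (F n) (quad_test (@Sigma n)) @[n --> \oo] --> 0%E.
Proof.
move=> /is_omegaP om.
have uoo : nu_det (@Sigma n) / (2 * n%:R) - 8 @[n --> \oo] -->
    (+oo : set_system R).
  apply/cvgryPge => A.
  (* Chosen so that nu / (2 n) - 8 >= |A|. *)
  have A0 : 0 < 2 * (`|A| + 8) by rewrite mulr_gt0// ltr_pwDr.
  have [N _ HN] := om _ A0.
  exists (maxn N 1) => // n /=; rewrite geq_max => /andP[Nn n0].
  have nR : 0 < n%:R :> R by rewrite ltr0n.
  have := HN n Nn.
  rewrite (ger0_norm (ltW nR)) [X in _ <= X]ger0_norm; last first.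
    apply: sumr_ge0 => l _; apply: sumr_ge0 => i _; apply: sumr_ge0 => j _.
    by have /andP[] := S01 n0 l i j.
  move=> nu; rewrite lerBrDr ler_pdivlMr ?mulr_gt0//; apply: le_trans nu.
  by rewrite mulrA (mulrC _ 2) ler_pM2r// ler_pM2l// lerD2r ler_norm.
apply: (@cvg_expR_bound _ _ _ _ _ _ uoo uoo).
  by move=> n; exact: risk_ge0.
exists 4%N => // n /= n4; have n0 : (0 < n)%N by exact: leq_trans n4.
rewrite EFinD opprB; apply: leeD.
  exact: quad_test_H0.
exact: (quad_test_H1 n4 (Fk n0) (S01 n0)).
Qed.

(** Here [L] bounds the log-number of template-block pairs. The null error is at most exp(- delta L)
    <= n^(- delta), and the other at most exp(- (1 + delta) L / 2) <= n^(-1/2). *)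
Lemma scan_risk_cvg0 (delta : R) (L : nat -> R) : 0 < delta ->
  (forall n, (0 < n)%N -> (m n)%:R * #|F n|%:R <= expR (L n)) ->
  (forall n, (0 < n)%N -> ln n%:R <= L n) ->
  (\forall n \near \oo, 18 * (1 + delta) * L n <= max_KL (@Sigma n)) ->
  risk (@Sigma n) (F n) (scan_test (@Sigma n) (F n) ((1 + delta) * L n))
    @[n --> \oo] --> 0%E.
Proof.
move=> delta0 mFL lnL KLL.
have ln_oo (c : R) : 0 < c -> c * ln n%:R @[n --> \oo] --> (+oo : set_system R).
  move=> c0; apply/cvgryPge => A.
  have /cvgryPge/(_ (A / c)) := @cvg_ln_natr R.
  by apply: filterS => n; rewrite ler_pdivrMr// mulrC.
apply: (@cvg_expR_bound _ _ _ _ _ _ (ln_oo delta delta0) (ln_oo 2^-1 _)) => //.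
  by move=> n; exact: risk_ge0.
case: KLL => N _ HN; exists (maxn N 1) => // n /=.
rewrite geq_max => /andP[/HN/= KLn n0].
have [k0 m0 kn] := Hkm n0.
have ln0 : 0 <= ln n%:R :> R by rewrite ln_ge0// ler1n.
have Ln := lnL n n0.
rewrite EFinD; apply: leeD.
  apply: le_trans (scan_test_H0 _ _ (S01 n0)) _; rewrite lee_fin.
  apply: (@le_trans _ _ (expR (L n) * expR (- ((1 + delta) * L n)))).
    by rewrite ler_pM2r ?expR_gt0// mFL.
  by rewrite -expRD ler_expR; nra.
apply: le_trans (scan_test_H1 _ m0 (Fk n0) (S01 n0)) _.
by rewrite lee_fin ler_expR; nra.
Qed.

End asymptotics.

Theorem theorem2 (R : realType) (k m : nat -> nat)
    (Sigma : forall n, 'I_(m n) -> 'M[R]_(k n)) (theta0 delta : R)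
    (Hkm : forall n, (0 < n)%N ->
       [/\ (0 < k n)%N, (0 < m n)%N & (m n * k n <= n)%N])
    (Htheta0 : 0 <= theta0 < 1)
    (HSigma : forall n, (0 < n)%N ->
       forall l u v, 0 <= Sigma n l u v <= theta0)
    (Hdelta : 0 < delta) :
  [/\ (is_omega (fun n => nu_det (Sigma n)) (fun n => n%:R) ->
       [/\ risk (Sigma n) (blocks (k n) n)
             (quad_test (Sigma n)) @[n --> \oo] --> 0%E,
           risk (Sigma n) (con_blocks (k n) n)
             (quad_test (Sigma n)) @[n --> \oo] --> 0%E
         & risk (Sigma n) (circ_blocks (k n) n)
             (quad_test (Sigma n)) @[n --> \oo] --> 0%E]),
      (is_omega (fun n => max_KL (Sigma n))
         (fun n => (k n)%:R * ln (n%:R / (k n)%:R) + ln (m n)%:R) ->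
       is_omega (fun n => max_KL (Sigma n)) (fun n => (k n)%:R) ->
       risk (Sigma n) (blocks (k n) n)
         (scan_test (Sigma n) (blocks (k n) n)
            (scan_threshold (k n) (m n) n delta)) @[n --> \oo] --> 0%E)
    & (is_omega (fun n => max_KL (Sigma n))
         (fun n => ln n%:R + ln (m n)%:R) ->
       risk (Sigma n) (con_blocks (k n) n)
         (scan_test (Sigma n) (con_blocks (k n) n)
            (con_scan_threshold (m n) n delta)) @[n --> \oo] --> 0%E /\
       risk (Sigma n) (circ_blocks (k n) n)
         (scan_test (Sigma n) (circ_blocks (k n) n)
            (con_scan_threshold (m n) n delta)) @[n --> \oo] --> 0%E)].
Proof.
have Hk n : (0 < n)%N -> [/\ (0 < k n)%N, (0 < m n)%N & (k n <= n)%N].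
  move=> /Hkm[k0 m0 mkn]; split=> //; apply: leq_trans mkn.
  exact: leq_pmull.
have S01 n : (0 < n)%N -> forall l u v, 0 <= Sigma n l u v <= 1.
  move=> n0 l u v; have /andP[-> /le_trans->//] := HSigma n n0 l u v.
  by have /andP[_ /ltW] := Htheta0.
have bk n : (0 < n)%N -> blocks (k n) n \subset blocks (k n) n by [].
have conk n : (0 < n)%N -> con_blocks (k n) n \subset blocks (k n) n.
  by move=> /Hk[_ _]; exact: con_blocks_sub.
have circk n : (0 < n)%N -> circ_blocks (k n) n \subset blocks (k n) n.
  by move=> /Hk[_ _]; exact: circ_blocks_sub.
have KL0 n : 0 <= max_KL (Sigma n) by apply/bigmax_geP; left.
have delta1 : 0 < 1 + delta by rewrite addr_gt0.
split.
- by move=> om; split; exact: quad_risk_cvg0.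
- move=> /is_omegaP om1 /is_omegaP om2.
  apply: (scan_risk_cvg0 Hk S01 bk Hdelta).
  + move=> n n0; have [k0 m0 kn] := Hk n n0.
    have k0n : (0 < k n <= n)%N by rewrite k0.
    rewrite expRD lnK ?posrE ?ltr0n// mulrC ler_pM2r ?ltr0n//.
    rewrite card_blocks natrX -mulrA expRM_natl lerXn2r ?nnegrE ?expR_ge0//.
    exact: bin_le_expR.
  + move=> n n0; have [k0 m0 kn] := Hk n n0.
    have k0n : (0 < k n <= n)%N by rewrite k0.
    have := ln_le_block_entropy R k0n.
    have : 0 <= ln (m n)%:R :> R by rewrite ln_ge0// ler1n.
    have : 0 <= ln n%:R :> R by rewrite ln_ge0// ler1n.
    by rewrite -!mulrA; lra.
  (* Here L = 2 k + 2 k ln (n / k) + ln m. Each growth hypothesis pays with half of the signal, and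
     72 / 2 = 18 * 2. *)
  have C0 : 0 < 72 * (1 + delta) by rewrite mulr_gt0.
  have [N1 _ H1] := om1 _ C0; have [N2 _ H2] := om2 _ C0.
  exists (maxn (maxn N1 N2) 1) => // n /=.
  rewrite !geq_max => /andP[/andP[/H1/= {}H1 /H2/= {}H2] n0].
  move: H1 H2; have [k0 m0 kn] := Hk n n0.
  have kR : 0 < (k n)%:R :> R by rewrite ltr0n.
  have nR : 0 < n%:R :> R by rewrite ltr0n.
  have lnm : 0 <= ln (m n)%:R :> R by rewrite ln_ge0// ler1n.
  have -> : ln (expR 1 * n%:R / (k n)%:R) = 1 + ln (n%:R / (k n)%:R) :> R.
    by rewrite -mulrA lnM ?posrE ?expR_gt0 ?divr_gt0// expRK.
  rewrite (ger0_norm (KL0 n)) (ger0_norm (ltW kR)).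
  set x := (k n)%:R * ln _; set y := `| _ |; set z := max_KL _.
  rewrite (_ : _ * _ * (1 + _) = 2 * (k n)%:R + 2 * x); last first.
    by rewrite /x; ring.
  move=> yz kz; have xy : x + ln (m n)%:R <= y by exact: ler_norm.
  have := ler_wpM2l (ltW delta1) xy.
  have := mulr_ge0 (ltW delta1) lnm; lra.
- move=> /is_omegaP om.
  have L0 n : (0 < n)%N -> 0 <= ln n%:R :> R.
    by move=> n0; rewrite ln_ge0// ler1n.
  (* Both consecutive families at once: all that matters is that they consist of k by k blocks and
     have at most n^2 members. *)
  have main (F : forall n, {set block n}) :
      (forall n, (0 < n)%N -> F n \subset blocks (k n) n) ->
      (forall n, (0 < n)%N -> (#|F n| <= n ^ 2)%N) ->
      risk (Sigma n) (F n) (scan_test (Sigma n) (F n)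
        (con_scan_threshold (m n) n delta)) @[n --> \oo] --> 0%E.
    move=> Fk Fn; apply: (scan_risk_cvg0 Hk S01 Fk Hdelta).
    + move=> n n0; have [k0 m0 kn] := Hk n n0.
      rewrite expRD lnK ?posrE ?ltr0n// mulrC ler_pM2r ?ltr0n//.
      by rewrite expRM_natl lnK ?posrE ?ltr0n// -natrX ler_nat Fn.
    + move=> n n0; have [k0 m0 kn] := Hk n n0.
      by have := L0 n n0; have := L0 (m n) m0; lra.
    (* 36 = 18 * 2, as 2 ln n + ln m <= 2 (ln n + ln m). *)
    have C0 : 0 < 36 * (1 + delta) by rewrite mulr_gt0.
    have [N _ HN] := om _ C0.
    exists (maxn N 1) => // n /=; rewrite geq_max => /andP[/HN/= + n0].
    have [k0 m0 kn] := Hk n n0.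
    have lnn := L0 n n0; have lnm := L0 (m n) m0.
    rewrite (ger0_norm (KL0 n)) ger0_norm ?addr_ge0//.
    by move: delta1 lnn lnm; nra.
  split; apply: main => // n n0; have [k0 m0 kn] := Hk n n0.
    by apply: card_con_blocks; rewrite k0.
  exact: card_circ_blocks.
Qed.
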